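(* Let $\mu=(A,B,C,D)$ be a real unimodular matrix with $B\neq 0$, let $M\ge 2$ and $N\ge 1$ be integers, let $r$ be an odd integer with $1\le r\le 2N-1$ relatively prime to $N$, and let $\Lambda=\{0,r/N\}+2\mathbb Z$. Let $\{V_j^\mu\}_{j\in\mathbb Z}$ be a vector-valued nonuniform multiresolution analysis associated with the linear canonical transform (LCT-VNUMRA) of $L^2(\mathbb R,\mathbb C^M)$ with vector-valued scaling function $\mathbf\Phi$. Put $\mathbf\Psi_0=\mathbf\Phi$ and let $\mathbf\Psi_1,\dots,\mathbf\Psi_{2N-1}$ be functions in $V_1^\mu$. Suppose that the system $$\Big\{\mathbf\Psi_k(t-\lambda)\,e^{-\frac{i\pi A}{B}(t^2-\lambda^2)}:\ \lambda\in\Lambda,\ k=0,1,\dots,2N-1\Big\}$$ is orthonormal in $V_1^\mu$. Then this system (with $k=0,1,\dots,2N-1$) is complete in $W_0^\mu=V_1^\mu\ominus V_0^\mu$.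
   Context: Notation. $L^2(\mathbb R,\mathbb C^M)$ is the space of column-vector-valued functions $\mathbf f=(f_1,\dots,f_M)^T$ with all $f_t\in L^2(\mathbb R)$, with norm $\|\mathbf f\|_2=(\sum_{t=1}^M\int_{\mathbb R}|f_t(x)|^2dx)^{1/2}$. For $\mathbf f,\mathbf g\in L^2(\mathbb R,\mathbb C^M)$ the vector-valued inner product is $\langle\mathbf f,\mathbf g\rangle=\int_{\mathbb R}\mathbf f(x)\overline{\mathbf g(x)}\,dx$, an $M\times M$ matrix, where the overline on a vector or matrix denotes the conjugate transpose. A family $\{\mathbf f_\alpha\}$ is orthonormal if $\langle\mathbf f_\alpha,\mathbf f_\beta\rangle=\delta_{\alpha,\beta}I_M$, where $I_M$ is the $M\times M$ identity. Completeness of a system in a subspace means that the functions of the subspace can be expanded in the system with constant $M\times M$ matrix coefficients. LCT-VNUMRA. A sequence of closed subspaces $\{V_j^\mu\}_{j\in\mathbb Z}$ of $L^2(\mathbb R,\mathbb C^M)$ such that: (a) $V_j^\mu\subset V_{j+1}^\mu$ for all $j$; (b) $\bigcup_j V_j^\mu$ is dense in $L^2(\mathbb R,\mathbb C^M)$; (c) $\bigcap_jV_j^\mu=\{\mathbf 0\}$; (d) $\mathbf f(t)\in V_j^\mu$ if and only if $\mathbf f(2Nt)e^{-i\pi A(1-(2N)^2)t^2/B}\in V_{j+1}^\mu$, for all $j$; (e) there is a function $\mathbf\Phi$ in $V_0^\mu$ (the vector-valued scaling function) such that $\{\mathbf\Phi(t-\lambda)e^{-\frac{i\pi A}{B}(t^2-\lambda^2)}:\lambda\in\Lambda\}$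 is a complete orthonormal basis of $V_0^\mu$. $W_0^\mu=V_1^\mu\ominus V_0^\mu$ is the orthogonal complement of $V_0^\mu$ in $V_1^\mu$. *)

(* Defs.v *)
From HB Require Import structures.
From mathcomp Require Import all_boot all_order all_algebra finmap.
From mathcomp Require Import all_classical all_reals all_analysis.
From mathcomp Require Import complex.

Set Implicit Arguments.
Unset Strict Implicit.
Unset Printing Implicit Defensive.

Import Order.TTheory GRing.Theory Num.Theory.
Import numFieldNormedType.Exports.

Local Open Scope classical_set_scope.
Local Open Scope ring_scope.
Local Open Scope complex_scope.

Definition expi {R : realType} (theta : R) : R[i] := cos theta +i* sin theta.

Definition cintegral {R : realType} (h : R -> R[i]) : R[i] :=
  (\int[lebesgue_measure]_x complex.Re (h x)) +i* (\int[lebesgue_measure]_x complex.Im (h x)).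

(* Elements of L^2(R, C^M) are represented by (Borel measurable) functions,
   equality in L^2 being equality almost everywhere. *)
Notation vfun R M := (R -> 'cV[R[i]]_M).

Section L2.
Context {R : realType} {M : nat}.
Implicit Types (f g : vfun R M) (V W : set (vfun R M)).

(* Extended-real valued, so that it is +oo, and not a junk value, outside L^2. *)
Definition l2norm f : \bar R :=
  ((\sum_(t < M) \int[lebesgue_measure]_x
      ((Normc.normc (f x t ord0) ^+ 2)%:E)) `^ 2^-1)%E.

Definition L2 : set (vfun R M) :=
  [set f : vfun R M | (forall t : 'I_M,
      measurable_fun [set: R] (fun x => complex.Re (f x t ord0)) /\
      measurable_fun [set: R] (fun x => complex.Im (f x t ord0)))
    /\ (l2norm f < +oo)%E].

Definition inner f g : 'M[R[i]]_M :=
  \matrix_(s, t) cintegral (fun x => (f x *m map_mx conjc (g x)^T) s t).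

(* Since g is in V as soon as it is in L^2 and at distance 0 from an element
   of V, a closed subspace is in particular stable under a.e. equality. *)
Record closed_subspace V : Prop := ClosedSubspace {
  subspace_L2 : V `<=` L2 ;
  subspace0 : V (fun=> 0) ;
  subspace_lin : forall (a : R[i]) f g, V f -> V g ->
    V (fun x => a *: f x + g x) ;
  subspace_closed : forall f, L2 f ->
    (forall e : R, 0 < e ->
       exists2 g, V g & (l2norm (fun x => (f x - g x)%R) < e%:E)%E) -> V f }.

(* Orthogonality in the complement is that of the Hilbert space L^2(R, C^M),
   whose scalar product is \sum_t \int f_t (g_t)^* = \tr (inner f g). *)
Definition orthocompl V W : set (vfun R M) :=
  [set f : vfun R M | V f /\ forall g, W g -> \tr (inner f g) = 0].

Section Systems.
Context {I : choiceType}.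
Implicit Types (D : set I) (F : I -> vfun R M).

Definition orthonormal_in V D F :=
  (forall i, D i -> V (F i)) /\
  (forall i j, D i -> D j -> inner (F i) (F j) = if i == j then 1%:M else 0).

(* The sum over the countable index set D is taken unconditionally: it is the
   L^2 limit of the net of partial sums over the finite subsets of D. *)
Definition has_expansion D F f :=
  exists C : I -> 'M[R[i]]_M, forall e : R, 0 < e ->
    exists2 K0 : {fset I}, [set` K0] `<=` D &
      forall K : {fset I}, [set` K0] `<=` [set` K] -> [set` K] `<=` D ->
        (l2norm (fun x => (f x - \sum_(i <- enum_fset K) C i *m F i x)%R)
           < e%:E)%E.

Definition complete_in V D F := forall f, V f -> has_expansion D F f.

End Systems.

Definition chirp_shift (A B : R) f (lambda : R) : vfun R M :=
  fun t => expi (- (pi * A / B * (t ^+ 2 - lambda ^+ 2))) *: f (t - lambda).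

Definition chirp_dilate (A B : R) (N : nat) f : vfun R M :=
  fun t => expi (- (pi * A * (1 - (2 * N%:R) ^+ 2) * t ^+ 2 / B))
             *: f (2 * N%:R * t).

End L2.

Definition Lambda {R : realType} (N r : nat) : set R :=
  [set x | exists n : int, x = 2 * n%:~R \/ x = r%:R / N%:R + 2 * n%:~R].

Record lct_vnumra {R : realType} {M : nat} (A B : R) (N r : nat)
    (V : int -> set (vfun R M)) (Phi : vfun R M) : Prop := LctVnumra {
  vnumra_subspace : forall j, closed_subspace (V j) ;
  vnumra_nested : forall j, V j `<=` V (j + 1) ;
  vnumra_dense : forall f, L2 f -> forall e : R, 0 < e ->
    exists2 g, (\bigcup_j V j) g & (l2norm (fun x => (f x - g x)%R) < e%:E)%E ;
  vnumra_trivial : \bigcap_j V j =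
    [set f : vfun R M | L2 f /\ {ae lebesgue_measure, forall x : R, f x = 0}] ;
  vnumra_dilation : forall j f, L2 f ->
    (V j f <-> V (j + 1) (chirp_dilate A B N f)) ;
  vnumra_scaling_mem : V 0 Phi ;
  vnumra_orthonormal :
    orthonormal_in (V 0) (Lambda N r) (chirp_shift A B Phi) ;
  vnumra_complete :
    complete_in (V 0) (Lambda N r) (chirp_shift A B Phi) }.

Definition wavelet_index {R : realType} (N r : nat) : set (nat * R) :=
  [set p | (p.1 <= 2 * N - 1)%N /\ Lambda N r p.2].

Definition wavelet_system {R : realType} {M : nat} (A B : R)
    (Psi : nat -> vfun R M) (p : nat * R) : vfun R M :=
  chirp_shift A B (Psi p.1) p.2.

(* Main.v *)
(* All of V_1 is seen as a left module over the M x M matrices. Pulling the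
   orthonormal basis of V_0 back along the dilation gives an orthonormal basis
   (e_lambda) of V_1, lambda in Lambda, with e_lambda(t) equal to sqrt(2N)
   Phi(2N t - lambda) up to chirp and phase. Up to unimodular factors, the
   Gram matrix <e_lambda, Psi_k(. - lambda')> does not change when lambda' moves by
   2m and lambda by 4Nm. Modulo these shifts there are 4N indices lambda and
   4N indices (k, lambda'). Hence the sum of the squared Frobenius norms of
   the Gram matrices over representatives of lambda and all (k, lambda')
   equals the sum over all lambda and representatives of (k, lambda'), which
   is 4N M by Parseval for (e_lambda). By Bessel each e_lambda contributes at
   most its squared norm M, so all these Bessel inequalities are equalities:
   every e_lambda lies in the closed span of the wavelet system, and so does
   V_1. *)
Require Import Defs.
From HB Require Import structures.
From mathcomp Require Import all_boot all_order all_algebra finmap.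
From mathcomp Require Import all_classical all_reals all_analysis.
From mathcomp Require Import complex.
From mathcomp Require Import measurable_realfun ring lra zify.

Set Implicit Arguments.
Unset Strict Implicit.
Unset Printing Implicit Defensive.

Import Order.TTheory GRing.Theory Num.Theory.
Import numFieldNormedType.Exports.

Local Open Scope classical_set_scope.
Local Open Scope ring_scope.
Local Open Scope complex_scope.

(** * Affine change of variables *)

Section affine_change_of_variables.
Context {R : realType}.
Notation mu := (@lebesgue_measure R).
Variables (a b : R).
Hypothesis a0 : 0 < a.

Let phi (x : measurableTypeR R) : measurableTypeR R := a * x + b.

Let measurable_phi : measurable_fun [set: measurableTypeR R] phi.
Proof.
by apply: measurable_funD => //; apply: measurable_funM => //.
Qed.

Let preim_phi (x y : R) :
  phi @^-1` `]x, y]%classic = `](x - b) / a, (y - b) / a]%classic.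
Proof.
apply/seteqP; split=> t /=; rewrite !in_itv /= /phi ltr_pdivrMr // ler_pdivlMr //;
  by rewrite ltrBlDr lerBrDr [t * a]mulrC.
Qed.

(** The push-forward is a measure by virtue of [measurable_phi], so it is packed together with that
    proof; the equation recovers its values. *)
Let pushforward_phi : {nu : {measure set (measurableTypeR R) -> \bar R} |
  nu = pushforward mu phi :> (set _ -> \bar R)}.
Proof.
unshelve eexists.
  refine (HB.pack (pushforward mu phi) (Measure.on (pushforward mu phi))).
  exact: measurable_phi.
by [].
Qed.

Let nu := proj1_sig pushforward_phi.

(** By uniqueness of Lebesgue measure only half-open intervals need testing, and their preimages
    under [phi] have length divided by [a]. *)
Lemma lebesgue_measure_affine (X : set (measurableTypeR R)) : measurable X ->
  mu X = mscale (NngNum (ltW a0)) nu X.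
Proof.
apply: lebesgue_measure_unique => _ [[x y] /= _ <-].
rewrite /mscale /nu (proj2_sig pushforward_phi) /pushforward preim_phi.
rewrite !lebesgue_measure_itv /= !lte_fin ltr_pM2r ?invr_gt0// ltrD2r.
case: ifP => _; last by rewrite mule0.
by rewrite -!EFinB -EFinM; congr EFin; field; rewrite gt_eqF.
Qed.

Lemma ge0_integral_affine (f : R -> \bar R) : measurable_fun [set: R] f ->
  (forall x, 0 <= f x)%E ->
  (\int[mu]_x f x = a%:E * \int[mu]_x f (a * x + b)%R)%E.
Proof.
move=> mf f0.
rewrite (eq_measure_integral (mscale (NngNum (ltW a0)) nu)); last first.
  by move=> X mX _; exact: lebesgue_measure_affine.
rewrite ge0_integral_mscale //=; congr (_ * _)%E.
rewrite /nu; have -> := proj2_sig pushforward_phi.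
by rewrite (ge0_integral_pushforward measurable_phi).
Qed.

Lemma measurable_fun_affine d (T : measurableType d) (f : R -> T) :
  measurable_fun [set: R] f -> measurable_fun [set: R] (fun x => f (a * x + b)).
Proof. by move=> mf; exact: (measurableT_comp mf measurable_phi). Qed.


Lemma integrable_affine (f : R -> R) : mu.-integrable [set: R] (EFin \o f) ->
  mu.-integrable [set: R] (fun x => (f (a * x + b))%:E).
Proof.
move=> /integrableP[mf foo]; apply/integrableP; split.
  exact: (measurable_fun_affine mf).
move: foo; rewrite (@ge0_integral_affine (fun x => `|(f x)%:E|%E)) //; last first.
  exact: measurableT_comp.
have I0 : (0 <= \int[mu]_x `|(f (a * x + b))%:E|)%E by exact: integral_ge0.
rewrite ltey => h.
rewrite ltey; apply: contraNneq h => ->.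
by rewrite gt0_muley ?lte_fin.
Qed.

Lemma Rintegral_affine (f : R -> R) : mu.-integrable [set: R] (EFin \o f) ->
  \int[mu]_x f x = a * \int[mu]_x f (a * x + b).
Proof.
move=> fi; have fi' := integrable_affine fi.
have /integrableP[mf _] := fi.
rewrite /Rintegral integralE [in RHS]integralE.
rewrite [X in (X - _)%E]ge0_integral_affine //; last exact: measurable_funepos.
rewrite [X in (_ - X)%E]ge0_integral_affine //; last exact: measurable_funeneg.
have p := integrable_fin_num measurableT (integrable_funepos measurableT fi').
have n := integrable_fin_num measurableT (integrable_funeneg measurableT fi').
(* [fine] distributes over the difference because the positive and negative parts both have finite
   integrals. *)
have fineMB (y z : \bar R) : y \is a fin_num -> z \is a fin_num ->
    fine (a%:E * y - a%:E * z)%E = a * fine (y - z)%E.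
  by move=> /fineK <- /fineK <- /=; rewrite mulrBr.
by rewrite -(fineMB _ _ p n); congr (fine (_ * _ - _ * _)%E);
  apply: eq_integral => x _;
  rewrite ?funeposE ?funenegE.
Qed.

End affine_change_of_variables.

(** * Complex-valued square-integrable functions *)

Section cintegral.
Context {R : realType}.
Notation mu := (@lebesgue_measure R).
Implicit Types (u v h : R -> R[i]).

Definition cintegrable h :=
  mu.-integrable [set: R] (fun x => (complex.Re (h x))%:E) /\
  mu.-integrable [set: R] (fun x => (complex.Im (h x))%:E).

Lemma Re_mulc (x y : R[i]) : complex.Re (x * y) =
  complex.Re x * complex.Re y - complex.Im x * complex.Im y.
Proof. by case: x => ? ?; case: y => ? ?. Qed.

Lemma Im_mulc (x y : R[i]) : complex.Im (x * y) =
  complex.Re x * complex.Im y + complex.Im x * complex.Re y.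
Proof. by case: x => ? ?; case: y => ? ?. Qed.

Lemma Re_addc (x y : R[i]) : complex.Re (x + y) = complex.Re x + complex.Re y.
Proof. by case: x => ? ?; case: y => ? ?. Qed.

Lemma Im_addc (x y : R[i]) : complex.Im (x + y) = complex.Im x + complex.Im y.
Proof. by case: x => ? ?; case: y => ? ?. Qed.

Lemma Re_conjc (x : R[i]) : complex.Re (conjc x) = complex.Re x.
Proof. by case: x. Qed.

Lemma Im_conjc (x : R[i]) : complex.Im (conjc x) = - complex.Im x.
Proof. by case: x. Qed.

Lemma eq_cintegral h k : h =1 k -> cintegral h = cintegral k.
Proof. by move=> /funext ->. Qed.

Lemma integrable_lin (a b : R) (f g : R -> R) :
  mu.-integrable [set: R] (EFin \o f) -> mu.-integrable [set: R] (EFin \o g) ->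
  mu.-integrable [set: R] (fun x => (a * f x + b * g x)%:E).
Proof.
move=> fi gi.
have := integrableD measurableT (integrableZl measurableT a fi)
  (integrableZl measurableT b gi).
exact.
Qed.

Lemma Rintegral_lin (a b : R) (f g : R -> R) :
  mu.-integrable [set: R] (EFin \o f) -> mu.-integrable [set: R] (EFin \o g) ->
  \int[mu]_x (a * f x + b * g x) = a * \int[mu]_x f x + b * \int[mu]_x g x.
Proof.
move=> fi gi; rewrite RintegralD // ?RintegralZl //.
- exact: (integrableZl measurableT a fi).
- exact: (integrableZl measurableT b gi).
Qed.

Lemma cintegrableD h k : cintegrable h -> cintegrable k ->
  cintegrable (fun x => h x + k x).
Proof.
move=> [h1 h2] [k1 k2]; split.
- under eq_fun do rewrite Re_addc EFinD; exact: integrableD.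
- under eq_fun do rewrite Im_addc EFinD; exact: integrableD.
Qed.

Lemma cintegralD h k : cintegrable h -> cintegrable k ->
  cintegral (fun x => h x + k x) = cintegral h + cintegral k.
Proof.
move=> [h1 h2] [k1 k2]; rewrite /cintegral.
under eq_Rintegral do rewrite Re_addc.
under [X in _ +i* X]eq_Rintegral do rewrite Im_addc.
by rewrite !RintegralD.
Qed.

Lemma cintegrableZ c h : cintegrable h -> cintegrable (fun x => c * h x).
Proof.
move=> [h1 h2]; split.
- under eq_fun do rewrite Re_mulc -mulNr; exact: integrable_lin.
- under eq_fun do rewrite Im_mulc; exact: integrable_lin.
Qed.

Lemma cintegralZ c h : cintegrable h ->
  cintegral (fun x => c * h x) = c * cintegral h.
Proof.
move=> [h1 h2]; rewrite /cintegral.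
under eq_Rintegral do rewrite Re_mulc -mulNr.
under [X in _ +i* X]eq_Rintegral do rewrite Im_mulc.
rewrite !Rintegral_lin //; case: c => c d /=.
by apply/eqP; rewrite eq_complex /= mulNr !eqxx.
Qed.

Lemma cintegral0 : cintegral (fun=> 0 : R[i]) = 0.
Proof. by rewrite /cintegral /= /Rintegral integral0. Qed.

Lemma cintegrable_sum (J : Type) (s : seq J) (F : J -> R -> R[i]) :
  (forall j, cintegrable (F j)) -> cintegrable (fun x => \sum_(j <- s) F j x).
Proof.
move=> Fi; elim: s => [|j s IH].
  by under eq_fun do rewrite big_nil; split; exact: integrable0.
by under eq_fun do rewrite big_cons; exact: cintegrableD.
Qed.

Lemma cintegral_sum (J : Type) (s : seq J) (F : J -> R -> R[i]) :
  (forall j, cintegrable (F j)) ->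
  cintegral (fun x => \sum_(j <- s) F j x) = \sum_(j <- s) cintegral (F j).
Proof.
move=> Fi; elim: s => [|j s IH].
  by under eq_cintegral do rewrite big_nil; rewrite big_nil cintegral0.
under eq_cintegral do rewrite big_cons; rewrite big_cons -IH cintegralD //.
exact: cintegrable_sum.
Qed.

Lemma cintegral_conjc h : cintegrable h ->
  cintegral (fun x => conjc (h x)) = conjc (cintegral h).
Proof.
move=> [h1 h2]; rewrite /cintegral /=.
under eq_Rintegral do rewrite Re_conjc.
under [X in _ +i* X]eq_Rintegral do rewrite Im_conjc -mulN1r.
by rewrite RintegralZl // mulN1r.
Qed.

Lemma cintegral_affine (a b : R) h : 0 < a -> cintegrable h ->
  cintegral h = a%:C * cintegral (fun x => h (a * x + b)).
Proof.
move=> a0 [h1 h2]; rewrite /cintegral.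
rewrite (Rintegral_affine b a0 h1) (Rintegral_affine b a0 h2).
by apply/eqP; rewrite eq_complex /= !mul0r subr0 addr0 !eqxx.
Qed.

(** The squared modulus as a real polynomial, free of the square root in [Normc.normc]. *)
Definition sqnormc (z : R[i]) : R := complex.Re z ^+ 2 + complex.Im z ^+ 2.

Lemma sqnormc_ge0 z : 0 <= sqnormc z.
Proof. by rewrite addr_ge0 ?sqr_ge0. Qed.

Lemma sqnormcM z w : sqnormc (z * w) = sqnormc z * sqnormc w.
Proof. by rewrite /sqnormc Re_mulc Im_mulc; ring. Qed.

Definition sq_integrable u :=
  [/\ measurable_fun [set: R] (fun x => complex.Re (u x)),
      measurable_fun [set: R] (fun x => complex.Im (u x)) &
      mu.-integrable [set: R] (fun x => (sqnormc (u x))%:E)].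

(** Both coordinates of the product are dominated by [|u|^2 + |v|^2]. *)
Lemma sq_integrable_mulJ u v : sq_integrable u -> sq_integrable v ->
  cintegrable (fun x => u x * conjc (v x)).
Proof.
move=> [mu1 mu2 ui] [mv1 mv2 vi].
have uvi := integrableD measurableT ui vi.
have norm_le (a b c d : R) : `|a * b + c * d| <= a ^+ 2 + c ^+ 2 + (b ^+ 2 + d ^+ 2).
  have := (sqr_ge0 (a + b), sqr_ge0 (a - b), sqr_ge0 (c + d), sqr_ge0 (c - d)).
  have := (sqr_ge0 a, sqr_ge0 b, sqr_ge0 c, sqr_ge0 d).
  by move=> [[[? ?] ?] ?] [[[? ?] ?] ?]; rewrite ler_norml; apply/andP; split; lra.
split.
- apply: (le_integrable _ _ _ uvi) => //.
    apply/measurable_EFinP.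
    under eq_fun do rewrite Re_mulc Re_conjc Im_conjc mulrN opprK.
    by apply: measurable_funD; apply: measurable_funM.
  move=> x _; rewrite lee_fin Re_mulc Re_conjc Im_conjc mulrN opprK.
  by rewrite (le_trans (norm_le _ _ _ _)) // ler_norm.
- apply: (le_integrable _ _ _ uvi) => //.
    apply/measurable_EFinP.
    under eq_fun do rewrite Im_mulc Re_conjc Im_conjc mulrN -mulNr.
    apply: measurable_funD; apply: measurable_funM => //.
    exact: measurableT_comp.
  move=> x _; rewrite lee_fin Im_mulc Re_conjc Im_conjc.
  rewrite (le_trans (norm_le _ _ _ _)) // sqrrN [X in _ + X <= _]addrC.
  exact: ler_norm.
Qed.

Lemma sq_integrable0 : sq_integrable (fun=> 0).
Proof.
split; rewrite //= /sqnormc;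
  under eq_fun do rewrite expr0n addr0; exact: integrable0.
Qed.

Lemma sq_integrableD u v : sq_integrable u -> sq_integrable v ->
  sq_integrable (fun x => u x + v x).
Proof.
move=> [mu1 mu2 ui] [mv1 mv2 vi].
have m1 : measurable_fun [set: R] (fun x => complex.Re (u x + v x)).
  by under eq_fun do rewrite Re_addc; apply: measurable_funD.
have m2 : measurable_fun [set: R] (fun x => complex.Im (u x + v x)).
  by under eq_fun do rewrite Im_addc; apply: measurable_funD.
split => //.
apply: (le_integrable _ _ _ (integrable_lin 2 2 ui vi)) => //.
  by apply/measurable_EFinP; apply: measurable_funD; apply: measurable_funX.
move=> x _; rewrite lee_fin /sqnormc Re_addc Im_addc ger0_norm ?addr_ge0 ?sqr_ge0 //.
rewrite (le_trans _ (ler_norm _)) //.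
have := (sqr_ge0 (complex.Re (u x) - complex.Re (v x)),
  sqr_ge0 (complex.Im (u x) - complex.Im (v x))).
by move=> [? ?]; lra.
Qed.

(** A multiplier of constant modulus covers both constant factors and chirps. *)
Lemma sq_integrable_mul (w : R -> R[i]) (c : R) u :
  measurable_fun [set: R] (fun x => complex.Re (w x)) ->
  measurable_fun [set: R] (fun x => complex.Im (w x)) ->
  (forall x, sqnormc (w x) = c) ->
  sq_integrable u -> sq_integrable (fun x => w x * u x).
Proof.
move=> mw1 mw2 wc [mu1 mu2 ui].
split.
- under eq_fun do rewrite Re_mulc.
  by apply: measurable_funB; apply: measurable_funM.
- under eq_fun do rewrite Im_mulc.
  by apply: measurable_funD; apply: measurable_funM.
- under eq_fun do rewrite sqnormcM wc EFinM.
  exact: (integrableZl measurableT c ui).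
Qed.

Lemma sq_integrableZ c u : sq_integrable u -> sq_integrable (fun x => c * u x).
Proof. exact: (@sq_integrable_mul (fun=> c)). Qed.

Lemma sq_integrable_sum (J : Type) (s : seq J) (F : J -> R -> R[i]) :
  (forall j, sq_integrable (F j)) -> sq_integrable (fun x => \sum_(j <- s) F j x).
Proof.
move=> Fs; elim: s => [|j s IH].
  by under eq_fun do rewrite big_nil; exact: sq_integrable0.
by under eq_fun do rewrite big_cons; exact: sq_integrableD.
Qed.

Lemma sq_integrable_affine (a b : R) u : 0 < a -> sq_integrable u ->
  sq_integrable (fun x => u (a * x + b)).
Proof.
move=> a0 [m1 m2 ui]; split.
- exact: (measurable_fun_affine a b m1).
- exact: (measurable_fun_affine a b m2).
- exact: (integrable_affine b a0 ui).
Qed.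

End cintegral.

(** * The matrix-valued inner product *)

Section adjoint.
Context {R : realType}.

Definition adjmx m n (X : 'M[R[i]]_(m, n)) : 'M[R[i]]_(n, m) := map_mx conjc X^T.

Lemma adjmxM m n p (X : 'M[R[i]]_(m, n)) (Y : 'M[R[i]]_(n, p)) :
  adjmx (X *m Y) = adjmx Y *m adjmx X.
Proof. by rewrite /adjmx trmx_mul map_mxM. Qed.

Lemma adjmxD m n (X Y : 'M[R[i]]_(m, n)) : adjmx (X + Y) = adjmx X + adjmx Y.
Proof. by rewrite /adjmx linearD map_mxD. Qed.

Lemma adjmxN m n (X : 'M[R[i]]_(m, n)) : adjmx (- X) = - adjmx X.
Proof. by rewrite /adjmx linearN map_mxN. Qed.

Lemma adjmxE m n (X : 'M[R[i]]_(m, n)) i j : adjmx X i j = conjc (X j i).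
Proof. by rewrite !mxE. Qed.

Lemma adjmx0 m n : adjmx (0 : 'M[R[i]]_(m, n)) = 0.
Proof. by apply/matrixP => i j; rewrite !mxE conjc0. Qed.

Lemma mulcJ (z : R[i]) : z * conjc z = (sqnormc z)%:C.
Proof.
by case: z => a b; apply/eqP; rewrite eq_complex /sqnormc /=; apply/andP; split;
  apply/eqP; ring.
Qed.

Lemma Re_sum (J : Type) (s : seq J) (P : pred J) (F : J -> R[i]) :
  complex.Re (\sum_(j <- s | P j) F j) = \sum_(j <- s | P j) complex.Re (F j).
Proof.
by elim/big_rec2: _ => // j x y _ <-; rewrite Re_addc.
Qed.

(** The squared Frobenius norm, in the trace form that arises when the squared norm of a matrix
    combination is expanded. *)
Definition frob M (X : 'M[R[i]]_M) : R := complex.Re (\tr (X *m adjmx X)).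

Lemma frobE M (X : 'M[R[i]]_M) : frob X = \sum_s \sum_t sqnormc (X s t).
Proof.
rewrite /frob /mxtrace Re_sum; apply: eq_bigr => s _.
rewrite mxE Re_sum; apply: eq_bigr => t _.
by rewrite !mxE mulcJ.
Qed.

Lemma frob_ge0 M (X : 'M[R[i]]_M) : 0 <= frob X.
Proof. by rewrite frobE; do 2 (apply: sumr_ge0 => ? _); exact: sqnormc_ge0. Qed.

Lemma frob_adjmx M (X : 'M[R[i]]_M) : frob (adjmx X) = frob X.
Proof.
rewrite !frobE exchange_big; do 2 (apply: eq_bigr => ? _); rewrite !mxE.
by rewrite /sqnormc Re_conjc Im_conjc sqrrN.
Qed.

Lemma frobZ M c (X : 'M[R[i]]_M) : frob (c *: X) = sqnormc c * frob X.
Proof.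
rewrite !frobE mulr_sumr; apply: eq_bigr => s _; rewrite mulr_sumr.
by apply: eq_bigr => t _; rewrite mxE sqnormcM.
Qed.

End adjoint.

Section L2_theory.
Context {R : realType} {M : nat}.
Notation mu := (@lebesgue_measure R).
Implicit Types (f g h : vfun R M) (C : 'M[R[i]]_M).

(* [inner] unfolds to integrals during unification, hence the lock. *)
Fact ip_key : unit. Proof. exact: tt. Qed.
Definition ip f g : 'M[R[i]]_M := locked_with ip_key inner f g.

Lemma innerE f g : inner f g = ip f g.
Proof. by rewrite /ip unlock. Qed.

(** The square of [l2norm f] when [f] is in [L2]; as the trace of a Gram matrix it expands by
    sesquilinearity. *)
Definition sqnorm f : R := complex.Re (\tr (ip f f)).

Lemma ipE f g s t :
  ip f g s t = cintegral (fun x => f x s ord0 * conjc (g x t ord0)).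
Proof.
by rewrite -innerE mxE; apply: eq_cintegral => x; rewrite mxE big_ord1 !mxE.
Qed.

Lemma sqr_normcE (z : R[i]) : Normc.normc z ^+ 2 = sqnormc z.
Proof. by case: z => a b /=; rewrite sqr_sqrtr // addr_ge0 ?sqr_ge0. Qed.

Lemma L2P f : L2 f <-> forall t, sq_integrable (fun x => f x t ord0).
Proof.
split=> [[mf foo] t|fi].
  have [m1 m2] := mf t; split => //.
  apply/integrableP; split.
    by apply/measurable_EFinP; apply: measurable_funD; exact: measurable_funX.
  under eq_integral do rewrite gee0_abs ?lee_fin ?sqnormc_ge0 // -sqr_normcE.
  rewrite ltey; apply: contraPneq foo => foo.
  (* One infinite component integral makes the sum [+oo], the other summands being nonnegative, and
     the power [2^-1] keeps it infinite. *)
  rewrite /l2norm (bigD1 t) //= foo addye ?poweRyr ?ltxx ?invr_eq0 //.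
  rewrite -ltNye (lt_le_trans (ltNyr 0)) // sume_ge0 // => s _.
  by apply: integral_ge0 => x _; rewrite lee_fin sqr_ge0.
split=> [t|]; first by have [] := fi t.
rewrite /l2norm; apply: poweR_lty; apply: lte_sum_pinfty => t _.
have [_ _ /integrableP[_]] := fi t.
by under eq_integral do rewrite gee0_abs ?lee_fin ?sqnormc_ge0 // -sqr_normcE.
Qed.

Lemma sqnormE f : L2 f ->
  sqnorm f = \sum_t \int[mu]_x sqnormc (f x t ord0).
Proof.
move=> /L2P fi; rewrite /sqnorm /mxtrace Re_sum; apply: eq_bigr => t _.
rewrite ipE /cintegral /=; apply: eq_Rintegral => x _.
by rewrite mulcJ.
Qed.

Lemma sqnorm_ge0 f : L2 f -> 0 <= sqnorm f.
Proof.
move=> /sqnormE ->; apply: sumr_ge0 => t _.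
by apply: Rintegral_ge0 => x _; exact: sqnormc_ge0.
Qed.

Lemma l2normE f : L2 f -> l2norm f = (Num.sqrt (sqnorm f))%:E.
Proof.
move=> f2; have /L2P fi := f2.
rewrite /l2norm (_ : (\sum_t _)%E = (sqnorm f)%:E); last first.
  rewrite sqnormE // -sumEFin; apply: eq_bigr => t _.
  have [_ _ ui] := fi t.
  rewrite /Rintegral fineK; last exact: (integrable_fin_num measurableT ui).
  by apply: eq_integral => x _; rewrite sqr_normcE.
by rewrite poweR_EFin powR12_sqrt // sqnorm_ge0.
Qed.

Lemma L2_0 : L2 (fun=> 0 : 'cV[R[i]]_M).
Proof. by apply/L2P => t; under eq_fun do rewrite mxE; exact: sq_integrable0. Qed.

Lemma L2D f g : L2 f -> L2 g -> L2 (fun x => f x + g x).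
Proof.
move=> /L2P fi /L2P gi; apply/L2P => t; under eq_fun do rewrite mxE.
exact: sq_integrableD.
Qed.

Lemma L2M C f : L2 f -> L2 (fun x => C *m f x).
Proof.
move=> /L2P fi; apply/L2P => t; under eq_fun do rewrite mxE.
by apply: sq_integrable_sum => s; exact: sq_integrableZ.
Qed.

Lemma L2_sum (J : eqType) (s : seq J) (F : J -> vfun R M) :
  (forall j, j \in s -> L2 (F j)) -> L2 (fun x => \sum_(j <- s) F j x).
Proof.
elim: s => [|j s IH] Fs.
  by under eq_fun do rewrite big_nil; exact: L2_0.
under eq_fun do rewrite big_cons; apply: L2D; first by apply: Fs; rewrite mem_head.
by apply: IH => k ks; apply: Fs; rewrite in_cons ks orbT.
Qed.

Lemma L2N f : L2 f -> L2 (fun x => - f x).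
Proof.
move=> /(L2M (-1)); under eq_fun do rewrite mulNmx mul1mx; exact.
Qed.

Lemma ip_adj f g : L2 f -> L2 g -> ip g f = adjmx (ip f g).
Proof.
move=> /L2P fi /L2P gi; apply/matrixP => s t.
rewrite [LHS]ipE [RHS]adjmxE [X in conjc X]ipE.
rewrite -cintegral_conjc; last exact: (sq_integrable_mulJ (fi _) (gi _)).
by apply: eq_cintegral => x; rewrite rmorphM /= conjcK mulrC.
Qed.

Lemma ipDl f g h : L2 f -> L2 g -> L2 h ->
  ip (fun x => f x + g x) h = ip f h + ip g h.
Proof.
move=> /L2P fi /L2P gi /L2P hi; apply/matrixP => s t; rewrite [LHS]ipE [RHS]mxE.
under eq_cintegral do rewrite mxE mulrDl.
rewrite cintegralD; last exact: (sq_integrable_mulJ (gi _) (hi _)).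
  by congr (_ + _); rewrite [RHS]ipE.
exact: (sq_integrable_mulJ (fi _) (hi _)).
Qed.

Lemma ipMl C f h : L2 f -> L2 h ->
  ip (fun x => C *m f x) h = C *m ip f h.
Proof.
move=> /L2P fi /L2P hi; apply/matrixP => s t; rewrite [LHS]ipE [RHS]mxE.
under eq_cintegral do rewrite mxE mulr_suml.
have fh k : cintegrable (fun x => f x k ord0 * conjc (h x t ord0)).
  exact: (sq_integrable_mulJ (fi _) (hi _)).
have fhC k : cintegrable (fun x => C s k * f x k ord0 * conjc (h x t ord0)).
  under eq_fun do rewrite -mulrA; exact: cintegrableZ.
rewrite cintegral_sum //; apply: eq_bigr => k _.
under eq_cintegral do rewrite -mulrA.
by rewrite cintegralZ // [X in _ = _ * X]ipE.
Qed.

Lemma ip0l h : ip (fun=> 0) h = 0.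
Proof.
apply/matrixP => s t; rewrite [LHS]ipE [RHS]mxE -(@cintegral0 R).
by apply: eq_cintegral => x; rewrite mxE mul0r.
Qed.

Lemma ipDr f g h : L2 f -> L2 g -> L2 h ->
  ip h (fun x => f x + g x) = ip h f + ip h g.
Proof.
move=> f2 g2 h2.
by rewrite (ip_adj (L2D f2 g2) h2) ipDl // adjmxD -(ip_adj f2 h2) -(ip_adj g2 h2).
Qed.

Lemma ipMr C f h : L2 f -> L2 h ->
  ip h (fun x => C *m f x) = ip h f *m adjmx C.
Proof.
move=> f2 h2.
by rewrite (ip_adj (L2M C f2) h2) ipMl // adjmxM -(ip_adj f2 h2).
Qed.

Lemma ipNl f h : L2 f -> L2 h -> ip (fun x => - f x) h = - ip f h.
Proof.
move=> f2 h2; rewrite (_ : (fun x => - f x) = fun x => - 1%:M *m f x); last first.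
  by apply/funext => x; rewrite mulNmx mul1mx.
by rewrite ipMl // mulNmx mul1mx.
Qed.

Lemma ip_suml (J : eqType) (s : seq J) (F : J -> vfun R M)
    (C : J -> 'M[R[i]]_M) h : (forall j, j \in s -> L2 (F j)) -> L2 h ->
  ip (fun x => \sum_(j <- s) C j *m F j x) h =
  \sum_(j <- s) C j *m ip (F j) h.
Proof.
move=> + h2; elim: s => [|j s IH] Fs.
  by under eq_fun do rewrite big_nil; rewrite big_nil ip0l.
under eq_fun do rewrite big_cons; rewrite big_cons.
have Fj : L2 (F j) by apply: Fs; rewrite mem_head.
have {}Fs k : k \in s -> L2 (F k) by move=> ks; apply: Fs; rewrite in_cons ks orbT.
rewrite ipDl ?IH ?ipMl //; first exact: L2M.
by apply: (L2_sum (F := fun j x => C j *m F j x)) => k ks; apply: L2M; exact: Fs.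
Qed.

(** The parallelogram law, with the nonnegative squared norm of [f - g] dropped. *)
Lemma sqnormD_le f g : L2 f -> L2 g ->
  sqnorm (fun x => f x + g x) <= 2 * sqnorm f + 2 * sqnorm g.
Proof.
move=> f2 g2; have g2' := L2N g2.
have trD (X Y : 'M[R[i]]_M) :
    complex.Re (\tr (X + Y)) = complex.Re (\tr X) + complex.Re (\tr Y).
  by rewrite mxtraceD Re_addc.
have trN (X : 'M[R[i]]_M) : complex.Re (\tr (- X)) = - complex.Re (\tr X).
  by apply/eqP; rewrite -addr_eq0 -trD addNr mxtrace0.
have ipNr h : L2 h -> ip h (fun x => - g x) = - ip h g.
  by move=> h2; rewrite (ip_adj g2' h2) ipNl // adjmxN -(ip_adj g2 h2).
have := sqnorm_ge0 (L2D f2 g2').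
rewrite /sqnorm !(ipDl, ipDr, ipNl, ipNr) ?trD ?trN //; try exact: L2D.
lra.
Qed.

End L2_theory.

(** * Orthonormal systems with matrix coefficients *)

(** The factors 2 are those of [sqnormD_le]. *)
Lemma quarter_bound (R : realFieldType) (e a b c d : R) :
  a <= c -> b <= d -> c < e / 4 -> d < e / 4 -> 2 * a + 2 * b < e.
Proof. lra. Qed.

Section orthonormal_systems.
Context {R : realType} {M : nat} {I : choiceType}.
Variables (D : set I) (F : I -> vfun R M).
Hypothesis F_orthonormal : orthonormal_in (@L2 R M) D F.

Implicit Types (f g h : vfun R M) (K : seq I).

Let ip_F i j : D i -> D j -> ip (F i) (F j) = if i == j then 1%:M else 0.
Proof. by rewrite -innerE; exact: F_orthonormal.2. Qed.

Let F_L2 K : {in K, forall i, D i} -> forall i, i \in K -> L2 (F i).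
Proof. by move=> KD i /KD; exact: F_orthonormal.1. Qed.

Lemma L2_lincomb (C : I -> 'M[R[i]]_M) K : {in K, forall i, D i} ->
  L2 (fun x => \sum_(i <- K) C i *m F i x).
Proof.
move=> /F_L2 Fi; apply: (L2_sum (F := fun j x => C j *m F j x)) => k ks.
by apply: L2M; exact: Fi.
Qed.

Lemma ip_lincomb (C : I -> 'M[R[i]]_M) K j : uniq K ->
  {in K, forall i, D i} -> j \in K ->
  ip (fun x => \sum_(i <- K) C i *m F i x) (F j) = C j.
Proof.
move=> uK KD jK; rewrite ip_suml; [|exact: (F_L2 KD)|exact: (F_L2 KD jK)].
rewrite (bigD1_seq j) //= (ip_F (KD _ jK) (KD _ jK)) eqxx mulmx1.
rewrite big_seq_cond big1 ?addr0 // => i /andP[iK ij].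
by rewrite (ip_F (KD _ iK) (KD _ jK)) (negbTE ij) mulmx0.
Qed.

Lemma sqnorm_pythagoras (C : I -> 'M[R[i]]_M) K g : uniq K ->
  {in K, forall i, D i} -> L2 g -> (forall j, j \in K -> ip g (F j) = 0) ->
  sqnorm (fun x => g x + \sum_(i <- K) C i *m F i x) =
  sqnorm g + \sum_(i <- K) frob (C i).
Proof.
move=> uK KD g2 gF; have S2 := L2_lincomb C KD.
have Sg h : L2 h -> ip (fun x => \sum_(i <- K) C i *m F i x) h =
    \sum_(i <- K) C i *m ip (F i) h.
  by move=> h2; apply: ip_suml => //; exact: (F_L2 KD).
have Sg0 : ip (fun x => \sum_(i <- K) C i *m F i x) g = 0.
  rewrite Sg // big_seq big1 // => i iK.
  by rewrite (ip_adj g2 (F_L2 KD iK)) gF // adjmx0 mulmx0.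
rewrite /sqnorm ipDl ?ipDr //; last exact: L2D.
rewrite (ip_adj S2 g2) Sg0 adjmx0 addr0 add0r Sg //.
rewrite mxtraceD Re_addc; congr (_ + _).
rewrite (big_morph _ (@mxtraceD _ M) (mxtrace0 _ M)) Re_sum.
rewrite big_seq [RHS]big_seq; apply: eq_bigr => i iK.
by rewrite (ip_adj S2 (F_L2 KD iK)) ip_lincomb.
Qed.

(** For a duplicate-free [K] inside [D], this is [f] minus its orthogonal projection onto the matrix
    combinations of the [F i]. *)
Definition residual K f : vfun R M :=
  fun x => f x - \sum_(i <- K) ip f (F i) *m F i x.

Lemma L2_residual K f : {in K, forall i, D i} -> L2 f -> L2 (residual K f).
Proof. by move=> KD f2; apply: L2D => //; apply: L2N; exact: L2_lincomb. Qed.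

Lemma ip_residual K f j : uniq K -> {in K, forall i, D i} -> L2 f ->
  j \in K -> ip (residual K f) (F j) = 0.
Proof.
move=> uK KD f2 jK; have Fj := F_L2 KD jK.
have S2 := L2_lincomb (fun i => ip f (F i)) KD.
by rewrite ipDl ?ipNl ?ip_lincomb ?subrr //; exact: L2N.
Qed.

Lemma sqnorm_residual K f : uniq K -> {in K, forall i, D i} -> L2 f ->
  sqnorm (residual K f) = sqnorm f - \sum_(i <- K) frob (ip f (F i)).
Proof.
move=> uK KD f2; apply/esym/eqP; rewrite subr_eq -sqnorm_pythagoras //; last first.
- by move=> j jK; exact: ip_residual.
- exact: L2_residual.
by apply/eqP; congr sqnorm; apply/funext => x; rewrite subrK.
Qed.

(** The two functions differ by a combination of the [F i], which is orthogonal to the residual, so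
    Pythagoras applies. *)
Lemma sqnorm_residual_min (C : I -> 'M[R[i]]_M) K f : uniq K ->
  {in K, forall i, D i} -> L2 f ->
  sqnorm (residual K f) <= sqnorm (fun x => f x - \sum_(i <- K) C i *m F i x).
Proof.
move=> uK KD f2.
rewrite [X in _ <= sqnorm X](_ : _ = (fun x => residual K f x +
    \sum_(i <- K) (ip f (F i) - C i) *m F i x)); last first.
  apply/funext => x; rewrite /residual -addrA; congr (_ + _).
  under [X in _ = _ + X]eq_bigr do rewrite mulmxBl.
  by rewrite sumrB addKr.
rewrite sqnorm_pythagoras //.
- by rewrite lerDl; apply: sumr_ge0 => i _; exact: frob_ge0.
- exact: L2_residual.
- by move=> j jK; exact: ip_residual.
Qed.

Lemma bessel K f : uniq K -> {in K, forall i, D i} -> L2 f ->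
  \sum_(i <- K) frob (ip f (F i)) <= sqnorm f.
Proof.
move=> uK KD f2; rewrite -subr_ge0 -sqnorm_residual //.
exact/sqnorm_ge0/L2_residual.
Qed.

Lemma sqnorm_residual_anti K K' f : uniq K -> uniq K' -> {subset K <= K'} ->
  {in K', forall i, D i} -> L2 f ->
  sqnorm (residual K' f) <= sqnorm (residual K f).
Proof.
move=> uK uK' KK' KD f2; have KD' : {in K, forall i, D i} by move=> i /KK'/KD.
rewrite !sqnorm_residual // lerD2l lerN2.
rewrite [leRHS](bigID [pred i | i \in K]) /= -[leLHS]addr0 lerD //; last first.
  by apply: sumr_ge0 => i _; exact: frob_ge0.
rewrite -[leRHS]big_filter [leRHS](perm_big K) //; apply: uniq_perm => //.
  exact: filter_uniq.
by move=> i; rewrite mem_filter andb_idr // => /KK'.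
Qed.

(** Membership in the closed span, with canonical coefficients and a single finite set per
    tolerance; this is easier to manipulate than [has_expansion], which quantifies over all larger
    finite sets. *)
Definition spanned f := forall e : R, 0 < e ->
  exists2 K : {fset I}, [set` K] `<=` D & sqnorm (residual (enum_fset K) f) < e.

Lemma spannedP f : L2 f -> spanned f <-> has_expansion D F f.
Proof.
move=> f2; split=> [fsp|[C fC] e e0].
  exists (fun i => ip f (F i)) => e e0.
  have [K0 K0D K0e] := fsp (e ^+ 2) (exprn_gt0 _ e0).
  exists K0 => // K K0K KD.
  rewrite l2normE; last exact: (L2_residual (K := enum_fset K)).
  rewrite lte_fin -[X in _ < X](ger0_norm (ltW e0)).
  rewrite -sqrtr_sqr ltr_sqrt ?exprn_gt0 //.
  apply: le_lt_trans K0e; apply: sqnorm_residual_anti => //; exact: fset_uniq.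
have se0 : 0 < Num.sqrt e by rewrite sqrtr_gt0.
have [K KD /(_ K (fun _ => id) KD) p] := fC _ se0.
exists K => //.
rewrite l2normE in p; last by apply: L2D => //; apply: L2N; exact: L2_lincomb.
move: p; rewrite lte_fin ltr_sqrt //; apply: le_lt_trans.
apply: sqnorm_residual_min => //; exact: fset_uniq.
Qed.

Lemma residualD K f g : {in K, forall i, D i} -> L2 f -> L2 g ->
  residual K (fun x => f x + g x) = (fun x => residual K f x + residual K g x).
Proof.
move=> KD f2 g2; apply/funext => x; rewrite /residual addrACA -opprD; congr (_ - _).
rewrite -big_split /= big_seq [RHS]big_seq; apply: eq_bigr => i iK.
by rewrite ipDl ?mulmxDl //; exact: (F_L2 KD).
Qed.

Lemma residualM K C f : {in K, forall i, D i} -> L2 f ->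
  residual K (fun x => C *m f x) = (fun x => C *m residual K f x).
Proof.
move=> KD f2; apply/funext => x; rewrite /residual mulmxBr; congr (_ - _).
rewrite mulmx_sumr big_seq [RHS]big_seq; apply: eq_bigr => i iK.
by rewrite ipMl ?mulmxA //; exact: (F_L2 KD).
Qed.

Lemma spannedD f g : L2 f -> L2 g -> spanned f -> spanned g ->
  spanned (fun x => f x + g x).
Proof.
move=> f2 g2 fsp gsp e e0.
have e4 : 0 < e / 4 by rewrite divr_gt0.
have [K KD Ke] := fsp _ e4; have [K' KD' Ke'] := gsp _ e4.
have UD : [set` (K `|` K')%fset] `<=` D.
  by move=> i /=; rewrite in_fsetU => /orP[/KD|/KD'].
exists (K `|` K')%fset => //.
rewrite residualD //; apply: le_lt_trans (sqnormD_le _ _) _; try exact: L2_residual.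
have h1 := sqnorm_residual_anti (fset_uniq K) (fset_uniq _)
  (@fsubsetP _ _ _ (fsubsetUl K K')) UD f2.
have h2 := sqnorm_residual_anti (fset_uniq K') (fset_uniq _)
  (@fsubsetP _ _ _ (fsubsetUr K K')) UD g2.
exact: (quarter_bound h1 h2 Ke Ke').
Qed.

(** Write [f] as [(f - g) + g]: taking residuals does not increase the norm of the first part, and
    the residual of [g] can be made small. *)
Lemma spanned_lim f : L2 f ->
  (forall e : R, 0 < e -> exists g,
     [/\ L2 g, spanned g & sqnorm (fun x => f x - g x) < e]) -> spanned f.
Proof.
move=> f2 fg e e0; have e4 : 0 < e / 4 by rewrite divr_gt0.
have [g [g2 gsp ge]] := fg _ e4; have [K KD Ke] := gsp _ e4.
have d2 : L2 (fun x => f x - g x) by apply: L2D => //; exact: L2N.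
exists K => //.
rewrite (_ : f = fun x => (f x - g x) + g x); last first.
  by apply/funext => x; rewrite subrK.
rewrite residualD //; apply: le_lt_trans (sqnormD_le _ _) _; try exact: L2_residual.
have h1 : sqnorm (residual (enum_fset K) (fun x => f x - g x)) <=
    sqnorm (fun x => f x - g x).
  rewrite sqnorm_residual // ?fset_uniq //.
  by rewrite gerBl; apply: sumr_ge0 => i _; exact: frob_ge0.
exact: (quarter_bound h1 (lexx _) ge Ke).
Qed.

Lemma spanned0 : spanned (fun=> 0).
Proof.
move=> e e0; exists fset0; first by move=> i /=; rewrite in_fset0.
rewrite /sqnorm (_ : residual _ _ = fun=> 0) ?ip0l ?mxtrace0 //.
by apply/funext => x; rewrite /residual big_nil subr0.
Qed.

(** The elementary matrix keeps only component [t] of the residual and moves it to row [s], so the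
    squared norm grows at most by the factor [sqnormc a]. *)
Lemma spanned_scale_delta (a : R[i]) s t f : L2 f -> spanned f ->
  spanned (fun x => (a *: delta_mx s t) *m f x).
Proof.
move=> f2 fsp e e0.
(* Adding 1 keeps the divisor positive even when [a] is 0. *)
have a1 : 0 < sqnormc a + 1 by rewrite ltr_wpDl ?sqnormc_ge0.
have [K KD Ke] := fsp _ (divr_gt0 e0 a1).
exists K => //; rewrite residualM //.
have G2 := L2_residual KD f2; move: Ke; set G := residual _ _ => Ke.
apply: (@le_lt_trans _ _ ((sqnormc a + 1) * sqnorm G)); last first.
  by rewrite mulrC -ltr_pdivlMr.
apply: (@le_trans _ _ (sqnormc a * sqnorm G)); last first.
  by rewrite ler_wpM2r ?sqnorm_ge0 // lerDl.
have E k x : ((a *: delta_mx s t) *m G x) k ord0 =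
    (if k == s then a * G x t ord0 else 0).
  rewrite -scalemxAl mxE mxE (bigD1 t) //= big1 ?addr0; last first.
    by move=> l lt; rewrite mxE (negbTE lt) andbF mul0r.
  by rewrite mxE eqxx andbT; case: eqP => _; rewrite ?mul1r // mul0r mulr0.
rewrite !sqnormE //; last exact: L2M.
rewrite (bigD1 s) //= [X in _ + X]big1 ?addr0; last first.
  move=> k ks; under eq_Rintegral do rewrite E (negbTE ks) /sqnormc expr0n addr0.
  by rewrite /Rintegral integral0.
under eq_Rintegral do rewrite E eqxx sqnormcM.
rewrite RintegralZl //; last by have /L2P/(_ t)[] := G2.
rewrite ler_wpM2l ?sqnormc_ge0 // (bigD1 t) //= lerDl.
apply: sumr_ge0 => k _; apply: Rintegral_ge0 => x _; exact: sqnormc_ge0.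
Qed.

(** Splitting [C] into elementary matrices replaces an operator norm estimate by the one-entry
    case. *)
Lemma spannedM C f : L2 f -> spanned f -> spanned (fun x => C *m f x).
Proof.
move=> f2 fsp; rewrite (matrix_sum_delta C).
have sum_spanned (J : Type) (s : seq J) (X : J -> 'M[R[i]]_M) :
    (forall j, spanned (fun x => X j *m f x)) ->
    spanned (fun x => (\sum_(j <- s) X j) *m f x).
  move=> Xsp; elim: s => [|j s IH].
    by under eq_fun do rewrite big_nil mul0mx; exact: spanned0.
  under eq_fun do rewrite big_cons mulmxDl.
  by apply: (spannedD (L2M _ f2) (L2M _ f2) (Xsp j) IH).
by do 2 (apply: (sum_spanned _ _ _) => ?); exact: spanned_scale_delta.
Qed.

Lemma spanned_lincomb (J : eqType) (s : seq J) (C : J -> 'M[R[i]]_M)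
    (G : J -> vfun R M) :
  (forall j, j \in s -> L2 (G j) /\ spanned (G j)) ->
  spanned (fun x => \sum_(j <- s) C j *m G j x).
Proof.
elim: s => [|j s IH] Gs; first by under eq_fun do rewrite big_nil; exact: spanned0.
under eq_fun do rewrite big_cons.
have {}IH : spanned (fun x => \sum_(j <- s) C j *m G j x).
  by apply: IH => k ks; apply: Gs; rewrite in_cons ks orbT.
have [Gj2 Gjs] := Gs j (mem_head _ _).
have S2 : L2 (fun x => \sum_(j <- s) C j *m G j x).
  apply: (L2_sum (F := fun j x => C j *m G j x)) => k ks; apply: L2M.
  by have [] := Gs k; rewrite // in_cons ks orbT.
exact: (spannedD (L2M _ Gj2) S2 (spannedM _ Gj2 Gjs) IH).
Qed.

End orthonormal_systems.

(** * Parseval's identity *)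

Section parseval.
Context {R : realType} {M : nat} {I : choiceType}.
Variables (D : set I) (F : I -> vfun R M).
Hypothesis F_orthonormal : orthonormal_in (@L2 R M) D F.

Let coef f i := (frob (ip f (F i)))%:E.

Lemma bessel_esum f : L2 f -> (\esum_(i in D) coef f i <= (sqnorm f)%:E)%E.
Proof.
move=> f2; apply: ge_ereal_sup => _ [X [finX XD] <-].
rewrite fsbig_finite // sumEFin lee_fin.
apply: (bessel F_orthonormal) => // i.
by rewrite in_fset_set // inE => /XD.
Qed.

(** The squared residual over a finite set is [sqnorm f] minus the partial sum over it, so it
    becomes arbitrarily small exactly when the supremum of the partial sums is [sqnorm f]. *)
Lemma spanned_parseval f : L2 f ->
  spanned D F f <-> \esum_(i in D) coef f i = (sqnorm f)%:E.
Proof.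
move=> f2; split=> [fsp|fE e e0].
  apply/eqP; rewrite eq_le bessel_esum //=.
  apply/lee_addgt0Pr => e e0; have [K KD Ke] := fsp _ e0.
  rewrite -leeBlDr //; apply: esum_ge; exists [set` K].
    by split => //; exact: finite_fset.
  rewrite fsbig_finite ?finite_fset // set_fsetK sumEFin -EFinB lee_fin.
  move: Ke; rewrite (sqnorm_residual F_orthonormal) ?fset_uniq //.
  by rewrite lerBlDr ltrBlDr addrC => /ltW.
have : ((sqnorm f - e)%:E < \esum_(i in D) coef f i)%E.
  by rewrite fE lte_fin gtrBl.
move=> /ereal_sup_gt[_ [X [finX XD] <-]].
rewrite fsbig_finite // sumEFin lte_fin => Xe.
have KD : [set` fset_set X] `<=` D by rewrite fset_setK.
exists (fset_set X) => //.
rewrite (sqnorm_residual F_orthonormal) ?fset_uniq //.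
by rewrite ltrBlDr -ltrBlDl.
Qed.

End parseval.

(** * Double counting over shift-invariant index sets *)

Section counting.
Context {R : realType}.

Lemma esum_fintype (T : finType) (f : T -> \bar R) : (forall t, 0 <= f t)%E ->
  \esum_(t in [set: T]) f t = (\sum_t f t)%E.
Proof.
move=> f0; rewrite esum_fset //; last exact: finite_finset.
rewrite (fsbigE (index_enum T)) ?index_enum_uniq //.
  by apply: eq_bigl => t; rewrite in_setT.
by move=> t _; rewrite mem_index_enum.
Qed.

Lemma esum_fintype_prod (T : finType) (J : choiceType) (f : T * J -> \bar R) :
  (forall k, 0 <= f k)%E ->
  \esum_(k in [set: T * J]) f k = (\sum_t \esum_(j in [set: J]) f (t, j))%E.
Proof.
move=> f0; rewrite -esum_fintype; last by move=> t; exact: esum_ge0.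
rewrite (@esum_esum _ _ _ _ (fun=> setT) (fun t j => f (t, j))) //.
rewrite (_ : _ `*`` _ = setT); last by apply/seteqP; split.
by apply: eq_esum => -[].
Qed.

(* Both index sets are free Z-sets with equally many orbits, and [a] is
   invariant under the diagonal shift: summing [a] over a transversal of the
   first set and all of the second gives the same total as the other way
   round. *)
Lemma esum_shift_eq (P Q : finType) (a : P * int -> Q * int -> \bar R) (c : R) :
  #|P| = #|Q| -> (forall k l, 0 <= a k l)%E ->
  (forall p q m, a (p, 0) (q, m) = a (p, - m) (q, 0)) ->
  (forall q, \esum_(k in setT) a k (q, 0) = c%:E) ->
  (forall p, \esum_(l in setT) a (p, 0%R) l <= c%:E)%E ->
  forall p, \esum_(l in setT) a (p, 0) l = c%:E.
Proof.
move=> PQ a0 ash aQ aP.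
have sumE : (\sum_p \esum_(l in setT) a (p, 0%R) l = \sum_(p : P) c%:E)%E.
  under eq_bigr do rewrite esum_fintype_prod //.
  rewrite exchange_big /=.
  transitivity (\sum_(q : Q) c%:E)%E; last first.
    by rewrite !sumEFin !sumr_const PQ.
  apply: eq_bigr => q _; rewrite -(aQ q) esum_fintype_prod //.
  apply: eq_bigr => p _.
  (* [ash] trades a shift [m] of the second index for [- m] on the first, hence the change of sign
     of the summation variable. *)
  rewrite [RHS](@reindex_esum _ _ _ setT setT (fun m : int => - m)).
    by apply: eq_esum => m _; rewrite ash.
  by split.
have fin p : \esum_(l in setT) a (p, 0) l \is a fin_num.
  rewrite ge0_fin_numE; last exact: esum_ge0.
  exact: (le_lt_trans (aP p) (ltry _)).
(* A single strict inequality would make the total strictly smaller, because the other sums are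
   finite. *)
move=> p; apply/eqP; rewrite eq_le aP /= leNgt; apply/negP => pc.
have : (\sum_p \esum_(l in setT) a (p, 0%R) l < \sum_(p : P) c%:E)%E.
  rewrite (bigD1 p) //= [ltRHS](bigD1 p) //=.
  apply: lte_leD => //; last by apply: lee_sum => q _; exact: aP.
  by apply/sum_fin_numP => t _ _; exact: fin.
by rewrite sumE ltxx.
Qed.

End counting.

(** * Chirps and dilations *)

Section chirps.
Context {R : realType}.

Lemma expiD (a b : R) : expi (a + b) = expi a * expi b.
Proof.
rewrite /expi cosD sinD; apply/eqP; rewrite eq_complex /=.
by rewrite eqxx addrC [cos a * sin b]mulrC [sin a * cos b]mulrC eqxx.
Qed.

Lemma expi0 : expi (0 : R) = 1.
Proof. by rewrite /expi cos0 sin0. Qed.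

Lemma conjcM (z w : R[i]) : conjc (z * w) = conjc z * conjc w.
Proof. exact: rmorphM. Qed.

Lemma conjc_expi (a : R) : conjc (expi a) = expi (- a).
Proof. by rewrite /expi cosN sinN. Qed.

Lemma sqnormc_expi (a : R) : sqnormc (expi a) = 1.
Proof. by rewrite /sqnormc /= cos2Dsin2. Qed.

Lemma sq_integrable_expi (theta : R -> R) u : measurable_fun [set: R] theta ->
  sq_integrable u -> sq_integrable (fun t => expi (theta t) * u t).
Proof.
move=> mth; apply: (@sq_integrable_mul _ _ 1) => [| |x]; last exact: sqnormc_expi.
- apply: (measurableT_comp (f := @cos R)) => //.
  exact: continuous_measurable_fun (@continuous_cos R).
- apply: (measurableT_comp (f := @sin R)) => //.
  exact: continuous_measurable_fun (@continuous_sin R).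
Qed.

End chirps.

Section dilation.
Context {R : realType} {M : nat}.
Variables (A B : R) (N : nat).
Hypothesis N_gt0 : (0 < N)%N.
Implicit Types (f g : vfun R M).

Let s : R := 2 * N%:R.
Let s_gt0 : 0 < s. Proof. by rewrite mulr_gt0 ?ltr0n. Qed.
Let s_neq0 : s != 0. Proof. exact: lt0r_neq0. Qed.

(** The substitution [x = s t] produces the Jacobian [s], and the chirp cancels against its
    conjugate. *)
Lemma ip_dilate f g : L2 f -> L2 g ->
  ip f g = s%:C *: ip (chirp_dilate A B N f) (chirp_dilate A B N g).
Proof.
move=> /L2P fi /L2P gi; apply/matrixP => i j.
rewrite [LHS]ipE [RHS]mxE [X in _ * X]ipE.
rewrite (cintegral_affine 0 s_gt0 (sq_integrable_mulJ (fi i) (gi j))).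
congr (_ * _); apply: eq_cintegral => t; rewrite addr0 /chirp_dilate [in RHS]mxE.
rewrite [X in _ = _ * conjc X]mxE conjcM conjc_expi mulrACA -expiD subrr expi0.
by rewrite mul1r.
Qed.

(** Serves to pull elements of [V 1] back to [V 0]; its phase is opposite to the one that the
    dilation adds. *)
Definition undilate f : vfun R M := fun t =>
  expi (pi * A * (1 - s ^+ 2) * (t / s) ^+ 2 / B) *: f (t / s).

Lemma dilateK f : chirp_dilate A B N (undilate f) = f.
Proof.
apply/funext => t; rewrite /chirp_dilate /undilate -/s scalerA -expiD.
by rewrite [s * t]mulrC mulfK // addNr expi0 scale1r.
Qed.

Lemma L2_undilate f : L2 f -> L2 (undilate f).
Proof.
move=> /L2P fi; apply/L2P => i; rewrite /undilate.
under eq_fun do rewrite mxE.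
apply: sq_integrable_expi.
  apply: measurable_funM => //; apply: measurable_funM => //.
  by apply: measurable_funX; apply: measurable_funM.
under eq_fun do rewrite mulrC -[s^-1 * _]addr0.
by apply: (@sq_integrable_affine _ s^-1 0 (fun t => f t i ord0)); rewrite ?invr_gt0.
Qed.

End dilation.

(** * Index sets *)

Section index.
Context {R : realType}.
Variables (N r : nat).
Hypotheses (N_gt0 : (0 < N)%N) (r_odd : odd r).

(** Coordinates on [Lambda]: [b] selects one of the two cosets of the even integers and [n] the
    position in it. *)
Definition node (b : bool) (n : int) : R := b%:R * (r%:R / N%:R) + 2 * n%:~R.

Lemma Lambda_node b n : Lambda N r (node b n).
Proof.
by exists n; case: b; rewrite /node ?mul0r ?add0r ?mul1r; [right|left].
Qed.

Lemma LambdaP (x : R) : Lambda N r x -> exists b n, x = node b n.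
Proof.
move=> [n [->|->]]; [exists false, n|exists true, n];
  by rewrite /node ?mul0r ?add0r ?mul1r.
Qed.

(** The two cosets are disjoint by parity: a common point would give [r + 2kN = 2k'N] with [r]
    odd. *)
Lemma node_inj b n b' n' : node b n = node b' n' -> b = b' /\ n = n'.
Proof.
have N0 : N%:R != 0 :> R by rewrite pnatr_eq0 -lt0n.
have nohalf k k' : r%:R / N%:R + 2 * k%:~R <> 2 * k'%:~R :> R.
  move=> /(congr1 (fun z : R => z * N%:R)).
  rewrite mulrDl divfK // => rE.
  have /eqP : (r%:Z + 2 * k * N%:Z)%:~R = (2 * k' * N%:Z)%:~R :> R.
    by rewrite rmorphD /= !rmorphM /=.
  rewrite eqr_int => /eqP rz.
  have rhalf : r = (r./2.*2).+1 by rewrite -[LHS]odd_double_half r_odd.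
  move: rz; rewrite rhalf.
  set x := (2 * k * N%:Z); set y := (2 * k' * N%:Z).
  have -> : x = 2 * (k * N%:Z) by rewrite /x mulrA.
  have -> : y = 2 * (k' * N%:Z) by rewrite /y mulrA.
  by move: (k * N%:Z) (k' * N%:Z) => u v; lia.
have two0 : (2 : R) != 0 by rewrite pnatr_eq0.
rewrite /node; case: b b' => [] [] /=; rewrite ?mul1r ?mul0r ?add0r.
- by move=> /addrI/(mulfI two0)/intr_inj.
- by move=> /nohalf.
- by move=> /esym/nohalf.
- by move=> /(mulfI two0)/intr_inj.
Qed.

(** This translation by [4Nm] is the one that, after dilation by [2N], matches a time shift by
    [2m]. *)
Lemma node_shift b n m :
  node b (n + (2 * N)%:Z * m) = node b n + 2 * (2 * N%:R * m%:~R).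
Proof.
by rewrite /node -addrA rmorphD rmorphM /= mulrDr -pmulrn natrM.
Qed.

(** Euclidean division of [n - j0] by [2N] splits each coset into [2N] orbits, [4N] in all. The free
    offset [j0] allows any chosen node to be a representative. *)
Lemma Lambda_bij (j0 : int) :
  set_bij [set: (bool * 'I_(2 * N)) * int] (@Lambda R N r)
   (fun x => node x.1.1 (j0 + x.1.2%:Z + (2 * N)%:Z * x.2)).
Proof.
have N2 : (0 < 2 * N)%N by rewrite muln_gt0.
split.
- by move=> x _; exact: Lambda_node.
- move=> [[b j] n] [[b' j'] n'] _ _ /= /node_inj[-> E].
  have {}E : (j%:Z + (2 * N)%:Z * n) = (j'%:Z + (2 * N)%:Z * n').
    by apply: (addrI j0); rewrite !addrA.
  have nn' : n = n'.
    have jn := ltn_ord j; have jn' := ltn_ord j'.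
    by nia.
  by move: E; rewrite nn' => /addIr [/val_inj ->].
- move=> x /LambdaP[b [n ->]].
  have jlt : (`|((n - j0) %% (2 * N)%:Z)%Z| < 2 * N)%N.
    rewrite -ltz_nat gez0_abs ?modz_ge0 ?ltz_pmod //.
    by rewrite gt_eqF // ltz_nat.
  exists ((b, Ordinal jlt), ((n - j0) %/ (2 * N)%:Z)%Z) => //=.
  rewrite gez0_abs ?modz_ge0 //; last by rewrite gt_eqF // ltz_nat.
  rewrite -addrA [_ * (_ %/ _)%Z]mulrC [X in j0 + X]addrC -divz_eq.
  by rewrite addrC subrK.
Qed.

(** The orbits come from [2N] generators and two cosets, again [4N] in all. *)
Lemma wavelet_index_bij :
  set_bij [set: ('I_(2 * N) * bool) * int] (@wavelet_index R N r)
   (fun x => (x.1.1 : nat, node x.1.2 x.2)).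
Proof.
have N2 : (0 < 2 * N)%N by rewrite muln_gt0.
split.
- move=> [[k b] n] _; split => /=; last exact: Lambda_node.
  by rewrite -ltnS subn1 prednK.
- by move=> [[k b] n] [[k' b'] n'] _ _ /= [/val_inj -> /node_inj[-> ->]].
- move=> [k x] [/= kN /LambdaP[b [n ->]]].
  have kN2 : (k < 2 * N)%N by move: kN; rewrite -ltnS subn1 prednK.
  by exists ((Ordinal kN2, b), n).
Qed.

End index.

(** * The dilated basis of V_1 *)

Section scaling_layer.
Context {R : realType} {M : nat}.
Variables (A B : R) (N r : nat).
Hypotheses (B_neq0 : B != 0) (N_gt0 : (0 < N)%N).
Variables (V : int -> set (vfun R M)) (Phi : vfun R M).
Hypothesis V_mra : lct_vnumra A B N r V Phi.

Let s : R := 2 * N%:R.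
Let s_gt0 : 0 < s. Proof. by rewrite mulr_gt0 ?ltr0n. Qed.

Notation dilate := (chirp_dilate A B N).
Notation F := (chirp_shift A B Phi).

Lemma ip_scalar (a : R[i]) (f g : vfun R M) : L2 f -> L2 g ->
  ip (fun x => a%:M *m f x) (fun x => a%:M *m g x) = (a * conjc a) *: ip f g.
Proof.
move=> f2 g2; rewrite ipMl ?ipMr //; last exact: L2M.
rewrite (_ : adjmx a%:M = (conjc a)%:M); last first.
  by rewrite /adjmx tr_scalar_mx map_scalar_mx.
by rewrite mul_scalar_mx mul_mx_scalar scalerA.
Qed.

Let V_L2 j f : V j f -> L2 f.
Proof. exact: (subspace_L2 (vnumra_subspace V_mra j)). Qed.

Let V_dilate f : V 0 f -> V 1 (dilate f).
Proof. by move=> Vf; apply/(vnumra_dilation V_mra 0) => //; exact: V_L2 Vf. Qed.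

(** The normalization whose squared modulus [s] cancels the Jacobian of [ip_dilate]. *)
Let root : R[i] := (Num.sqrt s)%:C.

Let rootJ : root * conjc root = s%:C.
Proof.
by rewrite mulcJ /sqnormc /= expr0n addr0 sqr_sqrtr // ltW.
Qed.

(** The basis of [V 1] carried over from [V 0]; the scalar is written as a matrix so that the lemmas
    on matrix coefficients apply. *)
Definition dilated_shift lam : vfun R M :=
  fun t => root%:M *m dilate (F lam) t.

Let F_V lam : Lambda N r lam -> V 0 (F lam).
Proof. exact: (vnumra_orthonormal V_mra).1. Qed.

Let F_orthonormal : orthonormal_in (@L2 R M) (Lambda N r) F.
Proof.
split; last exact: (vnumra_orthonormal V_mra).2.
by move=> lam /F_V /V_L2.
Qed.

Let dilate_L2 lam : Lambda N r lam -> L2 (dilate (F lam)).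
Proof. by move=> /F_V/V_dilate/V_L2. Qed.

Lemma L2_dilated_shift lam : Lambda N r lam -> L2 (dilated_shift lam).
Proof. by move=> /dilate_L2; exact: L2M. Qed.

Lemma dilated_shift_orthonormal :
  orthonormal_in (@L2 R M) (Lambda N r) dilated_shift.
Proof.
split=> [lam|lam lam' Dlam Dlam']; first exact: L2_dilated_shift.
rewrite innerE ip_scalar ?rootJ; [|exact: dilate_L2|exact: dilate_L2].
rewrite -(ip_dilate A B N_gt0) -?innerE;
  [|exact: V_L2 (F_V Dlam)|exact: V_L2 (F_V Dlam')].
exact: F_orthonormal.2.
Qed.

Lemma sqnorm_dilated_shift lam : Lambda N r lam ->
  sqnorm (dilated_shift lam) = M%:R.
Proof.
move=> Dlam; rewrite /sqnorm -innerE dilated_shift_orthonormal.2 // eqxx.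
by rewrite mxtrace1 -(rmorph_nat (real_complex R)).
Qed.

(** [root] occurs once in the coefficient and once in the basis function; the product is the
    Jacobian, which restores the coefficients of [h]. *)
Let residual_dilate (K : seq R) h : L2 h -> L2 (dilate h) ->
  {in K, forall lam, Lambda N r lam} ->
  residual dilated_shift K (dilate h) = dilate (residual F K h).
Proof.
move=> h2 dh2 KD; apply/funext => t.
rewrite /residual {3}/chirp_dilate scalerBr; congr (_ - _).
rewrite scaler_sumr big_seq [RHS]big_seq; apply: eq_bigr => lam /KD Dlam.
have FL2 := V_L2 (F_V Dlam); have dF2 := dilate_L2 Dlam.
rewrite /dilated_shift (ipMr _ dF2 dh2) (ip_dilate A B N_gt0 h2 FL2) mulmxA.
rewrite (_ : adjmx root%:M = (conjc root)%:M); last first.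
  by rewrite /adjmx tr_scalar_mx map_scalar_mx.
by rewrite !mul_mx_scalar scalerA rootJ -scalemxAr.
Qed.

Lemma sqnorm_dilate (f : vfun R M) : L2 f -> L2 (dilate f) ->
  sqnorm f = s * sqnorm (dilate f).
Proof.
move=> f2 df2; rewrite /sqnorm (ip_dilate A B N_gt0 f2 f2) linearZ /= Re_mulc /=.
by rewrite mul0r subr0.
Qed.

Lemma spanned_dilated_shift f : V 1 f -> spanned (Lambda N r) dilated_shift f.
Proof.
move=> Vf; pose h := undilate A B N f.
have fE : dilate h = f by exact: (dilateK A B N_gt0).
have f2 := V_L2 Vf.
have h2 : L2 h by exact: L2_undilate.
have Vh : V 0 h by apply/(vnumra_dilation V_mra 0) => //; rewrite fE.
have /(spannedP F_orthonormal h2) hsp := vnumra_complete V_mra Vh.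
(* Dilation divides squared norms by [s], so the tolerance [s * e] for [h] becomes [e] for [f]. *)
move=> e e0; have [K KD Ke] := hsp _ (mulr_gt0 s_gt0 e0).
have r2 : L2 (residual F K h) := L2_residual F_orthonormal KD h2.
have df2 : L2 (dilate h) by rewrite fE.
have rE := residual_dilate h2 df2 KD; rewrite fE in rE.
have dr2 : L2 (dilate (residual F K h)).
  by rewrite -rE; exact: (L2_residual dilated_shift_orthonormal KD f2).
exists K; first exact: KD.
rewrite rE -(ltr_pM2l s_gt0) -(sqnorm_dilate r2 dr2); exact: Ke.
Qed.

Variable Psi : nat -> vfun R M.

(** Up to the factor [pi * A / B], the dilation and the two shifts contribute the phases
    [-(1 - s^2) t^2], [-s^2 t^2] and [t^2], which add up to zero; only a phase constant in [t]
    survives. *)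
Lemma dilated_shift_mulJ lam k lam' t i j :
  dilated_shift lam t i ord0 * conjc (chirp_shift A B (Psi k) lam' t j ord0) =
  root * expi (pi * A / B * (lam ^+ 2 - lam' ^+ 2)) *
  (Phi (s * t - lam) i ord0 * conjc (Psi k (t - lam') j ord0)).
Proof.
rewrite /dilated_shift mul_scalar_mx /chirp_dilate /chirp_shift -/s.
rewrite mxE [X in _ * X * _]mxE [X in _ * (_ * X) * _]mxE [X in _ * conjc X]mxE.
rewrite conjcM conjc_expi opprK.
rewrite (_ : pi * A / B * (lam ^+ 2 - lam' ^+ 2) =
   - (pi * A * (1 - s ^+ 2) * t ^+ 2 / B)
   + - (pi * A / B * ((s * t) ^+ 2 - lam ^+ 2))
   + pi * A / B * (t ^+ 2 - lam' ^+ 2)); last by field.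
rewrite !expiD; ring.
Qed.

(** The constant phases have modulus one and drop out of [frob]. The remaining integrals agree after
    replacing [t] by [t + 2m], since [s (t + 2m) - (lam + 2sm) = s t - lam]. *)
Lemma frob_ip_shift k lam lam' (m : int) :
  L2 (Psi k) ->
  frob (ip (dilated_shift (lam + 2 * (s * m%:~R)))
           (chirp_shift A B (Psi k) (lam' + 2 * m%:~R))) =
  frob (ip (dilated_shift lam) (chirp_shift A B (Psi k) lam')).
Proof.
move=> /L2P P2.
have /L2P Phi2 : L2 Phi by exact: V_L2 (vnumra_scaling_mem V_mra).
pose G la la' i j t := Phi (s * t - la) i ord0 * conjc (Psi k (t - la') j ord0).
have Gi la la' i j : cintegrable (G la la' i j).
  apply: sq_integrable_mulJ.
    exact: (@sq_integrable_affine _ s (- la) (fun t => Phi t i ord0)).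
  have := @sq_integrable_affine _ 1 (- la') (fun t => Psi k t j ord0) ltr01 (P2 j).
  by under eq_fun do rewrite mul1r.
have ipG la la' : ip (dilated_shift la) (chirp_shift A B (Psi k) la') =
    (root * expi (pi * A / B * (la ^+ 2 - la' ^+ 2))) *:
    \matrix_(i, j) cintegral (G la la' i j).
  apply/matrixP => i j; rewrite [LHS]ipE [RHS]mxE [X in _ * X]mxE -cintegralZ //.
  by apply: eq_cintegral => t; exact: dilated_shift_mulJ.
rewrite [LHS](congr1 (@frob R M) (ipG _ _)) [RHS](congr1 (@frob R M) (ipG _ _)).
rewrite [LHS]frobZ [RHS]frobZ !sqnormcM !sqnormc_expi; congr (_ * frob _).
apply/matrixP => i j; rewrite [LHS]mxE [RHS]mxE.
rewrite (cintegral_affine (2 * m%:~R) ltr01 (Gi _ _ i j)) mul1r.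
apply: eq_cintegral => t; rewrite /G mul1r.
by congr (Phi _ _ _ * conjc (Psi k _ _ _)); ring.
Qed.

End scaling_layer.

(** * Equality in Bessel's inequalities and completeness of the wavelet system *)

Theorem theorem4p5 (R : realType) (A B C D : R)
    (unimodular : A * D - B * C = 1) (B_neq0 : B != 0)
    (M N r : nat) (M_ge2 : (2 <= M)%N) (N_ge1 : (1 <= N)%N)
    (r_odd : odd r) (r_bounds : (1 <= r <= 2 * N - 1)%N)
    (r_coprime : coprime r N)
    (V : int -> set (vfun R M)) (Phi : vfun R M)
    (V_mra : lct_vnumra A B N r V Phi)
    (Psi : nat -> vfun R M) (Psi0 : Psi 0%N = Phi)
    (Psi_V1 : forall k : nat, (1 <= k <= 2 * N - 1)%N -> V 1 (Psi k))
    (Psi_orthonormal :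
      orthonormal_in (V 1) (wavelet_index N r) (wavelet_system A B Psi)) :
  complete_in (orthocompl (V 1) (V 0))
    (wavelet_index N r) (wavelet_system A B Psi).
Proof.
move=> f [Vf _].
have V1_L2 := subspace_L2 (vnumra_subspace V_mra 1).
have W_orthonormal :
    orthonormal_in (@L2 R M) (wavelet_index N r) (wavelet_system A B Psi).
  by split => [p /Psi_orthonormal.1/V1_L2//|]; exact: Psi_orthonormal.2.
have Psi_L2 k : (k < 2 * N)%N -> L2 (Psi k).
  case: k => [_|k kN].
    rewrite Psi0; apply: (subspace_L2 (vnumra_subspace V_mra 0)).
    exact: vnumra_scaling_mem V_mra.
  by apply/V1_L2/Psi_V1; lia.
have e_orthonormal := dilated_shift_orthonormal N_ge1 V_mra.
pose W := wavelet_system A B Psi.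
pose e := dilated_shift A B N Phi.
have e_spanned lam : Lambda N r lam -> spanned (wavelet_index N r) W (e lam).
  move=> Dlam; have e2 : L2 (e lam) by exact: (L2_dilated_shift V_mra).
  have [b0 [j0 lamE]] := LambdaP Dlam.
  apply/(spanned_parseval W_orthonormal e2).
  rewrite (sqnorm_dilated_shift N_ge1 V_mra Dlam).
  rewrite (@reindex_esum _ _ _ _ _ _ _ (wavelet_index_bij N_ge1 r_odd)).
  have N2 : (0 < 2 * N)%N by rewrite muln_gt0.
  pose nd (x : (bool * 'I_(2 * N)) * int) : R :=
    node N r x.1.1 (j0 + x.1.2%:Z + (2 * N)%:Z * x.2).
  pose ix (y : ('I_(2 * N) * bool) * int) : nat * R :=
    (y.1.1 : nat, node N r y.1.2 y.2).
  have nd_Lambda x : Lambda N r (nd x) by exact: Lambda_node.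
  have ix_index y : wavelet_index N r (ix y).
    exact: (set_bij_homo (wavelet_index_bij N_ge1 r_odd)).
  have W_L2 y : L2 (W (ix y)) by exact: W_orthonormal.1.
  pose a x y : \bar R := (frob (ip (e (nd x)) (W (ix y))))%:E.
  (* Since the offset [j0] was read off from [lam], this node represents its own orbit, with
     remainder 0 and shift 0. *)
  have -> : lam = nd ((b0, Ordinal N2), 0).
    by rewrite lamE /nd /= mulr0 !addr0.
  apply: (@esum_shift_eq _ _ _ a M%:R).
  - by rewrite !card_prod mulnC.
  - by move=> x y; rewrite lee_fin frob_ge0.
  - move=> p q m; rewrite /a; congr EFin.
    (* Going from orbit position [- m] to 0 adds [4Nm], which compensates the shift by [2m] in the
       second index. *)
    have ndE : nd (p, 0) = nd (p, - m) + 2 * (2 * N%:R * m%:~R).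
      by rewrite -node_shift /nd /= mulr0 addr0 mulrN subrK.
    have ixE : node N r q.2 m = node N r q.2 0 + 2 * m%:~R :> R.
      by rewrite /node mulr0z mulr0 addr0.
    rewrite ndE /W /wavelet_system /= ixE.
    exact: (frob_ip_shift B_neq0 N_ge1 V_mra _ _ _ (Psi_L2 _ _)).
  (* Parseval in the basis [e] for an element of [V 1]; its coefficients are the adjoints of the
     matrices in [a], with the same [frob]. *)
  - move=> q; have V1W := Psi_orthonormal.1 _ (ix_index (q, 0)).
    have W_norm : sqnorm (W (ix (q, 0))) = M%:R.
      rewrite /sqnorm -innerE Psi_orthonormal.2 // eqxx mxtrace1.
      by rewrite -(rmorph_nat (real_complex R)).
    have /(spanned_parseval e_orthonormal (W_L2 (q, 0))) :=
      spanned_dilated_shift N_ge1 V_mra V1W.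
    rewrite W_norm (@reindex_esum _ _ _ _ _ _ _ (Lambda_bij N_ge1 r_odd j0)) => <-.
    apply: eq_esum => x _; rewrite /a; congr EFin.
    rewrite -frob_adjmx.
    by rewrite -(ip_adj (L2_dilated_shift V_mra (nd_Lambda x)) (W_L2 (q, 0))).
  (* Bessel for the wavelet system, each [e] having squared norm [M]. *)
  - move=> p; rewrite -(sqnorm_dilated_shift N_ge1 V_mra (nd_Lambda (p, 0))).
    have := bessel_esum W_orthonormal (L2_dilated_shift V_mra (nd_Lambda (p, 0))).
    by rewrite (@reindex_esum _ _ _ _ _ _ _ (wavelet_index_bij N_ge1 r_odd)).
have f2 := V1_L2 _ Vf.
apply/(spannedP W_orthonormal f2).
apply: (spanned_lim W_orthonormal f2) => eps eps0.
(* [f] is a limit of finite matrix combinations of the [e lam], all of which lie in the closed span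
   of the wavelet system. *)
have [K KD Ke] := spanned_dilated_shift N_ge1 V_mra Vf eps0.
exists (fun x => \sum_(lam <- enum_fset K) ip f (e lam) *m e lam x); split => //.
  exact: (L2_lincomb e_orthonormal).
apply: (spanned_lincomb W_orthonormal) => lam lamK; split; last exact/e_spanned/KD.
exact/(L2_dilated_shift V_mra)/KD.
Qed.
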